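(* For all $n\ge2$, the $n$-dimensional dual Apollonian group $\mathcal A_n^{\perp}=\langle\mathbf S_1^\perp,\dots,\mathbf S_{n+2}^\perp\rangle$ is a discrete subgroup of $GL(n+2,\mathbb R)$.
   Context: For $1\le j\le n+2$, $\mathbf S_j^\perp=\mathbf I_{n+2}+2\,\mathbf 1\mathbf e_j^T-4\,\mathbf e_j\mathbf e_j^T$, where $\mathbf e_j$ is the $j$-th standard column basis vector of $\mathbb{R}^{n+2}$ and $\mathbf 1=(1,\dots,1)^T$. That is, $\mathbf S_j^\perp$ agrees with the identity matrix except in column $j$, which has $-1$ on the diagonal and $2$ in all other positions. The dual Apollonian group $\mathcal A_n^\perp$ is the subgroup of $GL(n+2,\mathbb R)$ generated by these matrices. *)

(* Defs.v *)
From HB Require Import structures.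
From mathcomp Require Import all_boot all_order all_algebra.
From mathcomp Require Import ring.
From mathcomp Require Import all_classical all_reals all_analysis.
Import Order.TTheory GRing.Theory Num.Theory.
Import numFieldNormedType.Exports.

Set Implicit Arguments.
Unset Strict Implicit.
Unset Printing Implicit Defensive.

Local Open Scope classical_set_scope.
Local Open Scope ring_scope.

(* MathComp's 'GL_n[R] is restricted to finite rings, hence this version of
   GL(n, R), whose topology is induced by the one on matrices. *)
Record GL (R : realType) (n : nat) := MkGL {
  GLmx :> 'M[R]_n;
  GLmx_unit : GLmx \in unitmx
}.

Section GeneralLinearGroup.
Variables (R : realType) (n : nat).
Local Notation GLn := (GL R n).
Implicit Types A B C : GLn.

HB.instance Definition _ := [isSub for @GLmx R n].
HB.instance Definition _ := [Choice of GLn by <:].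

Lemma GL_one_subproof : (1%:M : 'M[R]_n) \in unitmx.
Proof. exact: unitmx1. Qed.

Lemma GL_inv_subproof A : invmx A \in unitmx.
Proof. by rewrite unitmx_inv GLmx_unit. Qed.

Lemma GL_mul_subproof A B : A *m B \in unitmx.
Proof. by rewrite unitmx_mul !GLmx_unit. Qed.

Definition GL_one : GLn := MkGL GL_one_subproof.
Definition GL_inv A : GLn := MkGL (GL_inv_subproof A).
Definition GL_mul A B : GLn := MkGL (GL_mul_subproof A B).

Lemma GL_mulA : associative GL_mul.
Proof. by move=> A B C; apply: val_inj; rewrite /= mulmxA. Qed.

Lemma GL_mul1 : left_id GL_one GL_mul.
Proof. by move=> A; apply: val_inj; rewrite /= mul1mx. Qed.

Lemma GL_mulr1 : right_id GL_one GL_mul.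
Proof. by move=> A; apply: val_inj; rewrite /= mulmx1. Qed.

Lemma GL_mulV : left_inverse GL_one GL_inv GL_mul.
Proof. by move=> A; apply: val_inj; rewrite /= mulVmx ?GLmx_unit. Qed.

Lemma GL_mulrV : right_inverse GL_one GL_inv GL_mul.
Proof. by move=> A; apply: val_inj; rewrite /= mulmxV ?GLmx_unit. Qed.

HB.instance Definition _ :=
  isGroup.Build GLn GL_mulA GL_mul1 GL_mulr1 GL_mulV GL_mulrV.

HB.instance Definition _ :=
  Topological.copy GLn (initial_topology (@GLmx R n)).

End GeneralLinearGroup.

Definition is_subgroup (G : groupType) (H : set G) : Prop :=
  group_closed (mem H).

Definition subgroup_generated (G : groupType) (S : set G) : set G :=
  smallest (@is_subgroup G) S.

(* The coercion of H to a type carries the subspace topology, which is required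
   to be discrete in the sense of [discreteNbhsType]. *)
Definition is_discrete_subset (T : topologicalType) (H : set T) : Prop :=
  (@nbhs H H) = principal_filter.

Definition is_discrete_subgroup (R : realType) (n : nat) (H : set (GL R n)) :
    Prop :=
  is_subgroup H /\ is_discrete_subset H.

Section DualApollonian.
Variables (R : realType) (n : nat).

Definition ebasis (j : 'I_n.+2) : 'cV[R]_n.+2 := delta_mx j 0.

Definition ones : 'cV[R]_n.+2 := const_mx 1.

Definition dual_apollonian_mx (j : 'I_n.+2) : 'M[R]_n.+2 :=
  1%:M + 2 *: (ones *m (ebasis j)^T) - 4 *: (ebasis j *m (ebasis j)^T).

Lemma ebasis_ones j : (ebasis j)^T *m ones = 1%:M.
Proof.
by apply/matrixP=> a b; rewrite !ord1 trmx_delta -rowE !mxE.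
Qed.

Lemma ebasis_ebasis j : (ebasis j)^T *m ebasis j = 1%:M.
Proof.
by apply/matrixP=> a b; rewrite !ord1 trmx_delta -rowE !mxE !eqxx.
Qed.

Lemma dual_apollonian_mx_invol j :
  dual_apollonian_mx j *m dual_apollonian_mx j = 1%:M.
Proof.
rewrite /dual_apollonian_mx.
set u := ones; set e := ebasis j.
have UU : (u *m e^T) *m (u *m e^T) = u *m e^T.
  by rewrite mulmxA -(mulmxA u) ebasis_ones mulmx1.
have UE : (u *m e^T) *m (e *m e^T) = u *m e^T.
  by rewrite mulmxA -(mulmxA u) ebasis_ebasis mulmx1.
have EU : (e *m e^T) *m (u *m e^T) = e *m e^T.
  by rewrite mulmxA -(mulmxA e) ebasis_ones mulmx1.
have EE : (e *m e^T) *m (e *m e^T) = e *m e^T.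
  by rewrite mulmxA -(mulmxA e) ebasis_ebasis mulmx1.
move: UU UE EU EE; set U := u *m e^T; set E := e *m e^T => UU UE EU EE.
rewrite !(mulmxDl, mulmxDr, mulNmx, mulmxN, mul1mx, mulmx1).
rewrite -!scalemxAl -!scalemxAr UU UE EU EE.
by apply/matrixP=> a b; rewrite !mxE; ring.
Qed.

Lemma dual_apollonian_mx_unit j : dual_apollonian_mx j \in unitmx.
Proof. by have [] := mulmx1_unit (dual_apollonian_mx_invol j). Qed.

Definition dual_apollonian_gen (j : 'I_n.+2) : GL R n.+2 :=
  MkGL (dual_apollonian_mx_unit j).

Definition dual_apollonian_group : set (GL R n.+2) :=
  subgroup_generated (range dual_apollonian_gen).

End DualApollonian.

Arguments dual_apollonian_mx R {n} j.
Arguments dual_apollonian_gen R {n} j.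
Arguments dual_apollonian_group R n : clear implicits.

(* Main.v *)
(** The generators are involutions with integer entries, so every element of
    the group has integer entries; distinct integer matrices have some entry
    differing by at least 1, so each element is isolated. *)

Require Import Defs.
From mathcomp Require Import all_boot all_order all_algebra.
From mathcomp Require Import all_classical all_reals all_analysis.

Import Order.TTheory GRing.Theory Num.Theory.
Import numFieldNormedType.Exports.

Local Open Scope classical_set_scope.
Local Open Scope ring_scope.

Lemma is_subgroupP (G : groupType) (H : set G) :
  is_subgroup H <-> H 1%g /\ (forall x y, H x -> H y -> H (x / y)%g).
Proof.
split=> -[H1 HV].
  split; first exact: set_mem.
  by move=> x y Hx Hy; apply: set_mem; apply: HV; apply: mem_set.
split; first exact: mem_set.
by move=> x y /set_mem Hx /set_mem Hy; apply: mem_set; exact: HV.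
Qed.

(** [smallest] is an intersection, and the subgroup conditions pass to intersections. *)
Lemma subgroup_generated_is_subgroup (G : groupType) (S : set G) :
  is_subgroup (subgroup_generated S).
Proof.
apply/is_subgroupP; split; first by move=> K [/is_subgroupP[]].
move=> x y Sx Sy K KS; have [/is_subgroupP[_ KV] _] := KS.
by apply: KV; [exact: Sx | exact: Sy].
Qed.

(** A copy of GL(n, Z). Asking for integrality of the inverse as well makes closure under inversion
    immediate, with no determinant argument. *)
Definition GL_int (R : realType) (n : nat) : set (GL R n) :=
  [set A | (A : 'M[R]_n) \is a mxOver Num.int /\
           invmx A \is a mxOver Num.int].

Lemma GL_int_is_subgroup (R : realType) (n : nat) : is_subgroup (@GL_int R n).
Proof.
apply/is_subgroupP; split.
  by split; rewrite /= ?invmx1; apply: mxOver_scalar;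
    rewrite ?rpred0 ?rpred1.
move=> A B [iA iA'] [iB iB'].
split; first exact: mxOverM.
have -> : invmx (A / B)%g = B *m invmx A :> 'M[R]_n.
  (* [invmx] here is by definition the matrix of the group inverse, so the group law (A / B)^-1 = B
     / A applies. *)
  by rewrite -[LHS]/(val (A / B)^-1%g) invgM invgK.
exact: mxOverM.
Qed.

Lemma dual_apollonian_mx_int (R : realType) (n : nat) (j : 'I_n.+2) :
  dual_apollonian_mx R j \is a mxOver Num.int.
Proof.
apply/mxOverP=> a b; rewrite !mxE !big_ord1 !mxE.
by apply: rpredB; first apply: rpredD;
  do ?[exact: natr_int | exact: (natr_int _ 1) | apply: rpredM].
Qed.

Lemma dual_apollonian_gen_int (R : realType) (n : nat) :
  range (@dual_apollonian_gen R n) `<=` @GL_int R n.+2.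
Proof.
move=> _ [j _ <-]; split; first exact: dual_apollonian_mx_int.
suff -> : invmx (dual_apollonian_gen R j) = dual_apollonian_mx R j :> 'M[R]_n.+2.
  exact: dual_apollonian_mx_int.
by rewrite /= -[LHS]mulmx1 -(dual_apollonian_mx_invol R j) mulKmx
  ?dual_apollonian_mx_unit.
Qed.

Lemma mxOver_int_isolated (R : realType) (m n : nat) (A : 'M[R]_(m, n)) :
  A \is a mxOver Num.int ->
  \forall B \near A, B \is a mxOver Num.int -> B = A.
Proof.
(* A matrix neighbourhood is given by one neighbourhood per entry. Radius 1 suffices: the ball is
   open, and a nonzero integer has norm at least 1. *)
move=> /mxOverP iA; exists (fun i j => ball (A i j) 1).
  by move=> i j; exact: nbhsx_ballx.
move=> B AB /mxOverP iB; apply/matrixP=> i j.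
apply/eqP; rewrite eq_sym -subr_eq0; apply/negPn/negP=> AB0.
have := AB i j; rewrite /ball /= ltNge => /negP; apply.
by apply: norm_intr_ge1; rewrite ?rpredB.
Qed.

Lemma isolated_is_discrete (T : topologicalType) (H : set T) :
  (forall x, H x -> \forall y \near x, H y -> y = x) -> is_discrete_subset H.
Proof.
move=> isoH; apply/funext=> x; apply/seteqP; split=> U.
  by move=> /nbhs_singleton Ux; apply/principal_filterP.
move=> /principal_filterP Ux.
(* The subspace topology is initial for [set_val], so the isolating neighbourhood pulls back to one
   whose only point is [x]. *)
have xH := @initial_continuous H T set_val x _ (isoH _ (set_valP x)).
apply: (@filterS _ (nbhs x) _ _ _ _ xH) => y /= yx.
by rewrite (_ : y = x) //; apply: val_inj; apply: yx; exact: set_valP.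
Qed.

Theorem theorem4p2 (R : realType) (n : nat) (hn : (2 <= n)%N) :
  is_discrete_subgroup (dual_apollonian_group R n).
Proof.
split; first exact: subgroup_generated_is_subgroup.
have sub : dual_apollonian_group R n `<=` @GL_int R n.+2.
  apply: smallest_sub; first exact: GL_int_is_subgroup.
  exact: dual_apollonian_gen_int.
apply: isolated_is_discrete => A /sub [iA _].
(* The topology of [GL] is initial for [GLmx], so isolation among integer matrices transfers to the
   group. *)
have nbA := @initial_continuous (GL R n.+2) _ (@GLmx R n.+2) A _
  (mxOver_int_isolated _ _ _ _ iA).
apply: (@filterS _ (nbhs A) _ _ _ _ nbA) => B /= BA /sub [iB _].
by apply: val_inj; exact: BA.
Qed.
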